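(* Writing $B_k^{nb}:=B_k^{neobc}$ and $C_k^{nb}:=C_k^{neobc}$, the Pell numbers $P_k$ and Pell-Lucas numbers $Q_k$ satisfy: $$P_{2n}=\frac13\begin{cases}4B^{nb}_{\frac{n+1}{2}}-C^{nb}_{\frac{n+1}{2}}-3 & n\geq1\text{ odd},\\ 20B^{nb}_{\frac{n+2}{2}}-7C^{nb}_{\frac{n+2}{2}}-15 & n\geq2\text{ even},\end{cases}$$ $$P_{2n-1}=\frac16\begin{cases}-16B^{nb}_{\frac{n+1}{2}}+6C^{nb}_{\frac{n+1}{2}}+12 & n\geq1\text{ odd},\\ 20B^{nb}_{\frac{n+2}{2}}-4B^{nb}_{\frac{n}{2}}-7C^{nb}_{\frac{n+2}{2}}+C^{nb}_{\frac{n}{2}}-12 & n\geq2\text{ even},\end{cases}$$ $$Q_{2n}=\frac13\begin{cases}-8B^{nb}_{\frac{n+1}{2}}+4C^{nb}_{\frac{n+1}{2}}+6 & n\geq1\text{ odd},\\ 60B^{nb}_{\frac{n+2}{2}}-4B^{nb}_{\frac{n}{2}}-21C^{nb}_{\frac{n+2}{2}}+C^{nb}_{\frac{n}{2}}-42 & n\geq2\text{ even},\end{cases}$$ $$Q_{2n-1}=\frac13\begin{cases}24B^{nb}_{\frac{n+1}{2}}-8C^{nb}_{\frac{n+1}{2}}-18 & n\geq1\text{ odd},\\ 20B^{nb}_{\frac{n+2}{2}}+4B^{nb}_{\frac{n}{2}}-7C^{nb}_{\frac{n+2}{2}}-C^{nb}_{\frac{n}{2}}-18 & n\geq2\text{ 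even}.\end{cases}$$
   Context: Pell numbers: $P_0=0,P_1=1,P_k=2P_{k-1}+P_{k-2}$; Pell-Lucas numbers: $Q_0=Q_1=2,Q_k=2Q_{k-1}+Q_{k-2}$. A positive integer $m$ is a neo balcobalancing number if there is a positive integer $r$ such that $(1+2+\cdots+(m-1))+(1+2+\cdots+m)=2[(m-1)+m+(m+1)+(m+2)+\cdots+(m+r)]$ (equivalently, $8m^2-12m+9$ is a perfect square). $B_k^{neobc}$ is the $k$-th neo balcobalancing number in increasing order ($k\ge1$) and $C_k^{neobc}=\sqrt{8(B_k^{neobc})^2-12B_k^{neobc}+9}$. *)

(* Defs.v *)
From mathcomp Require Import all_boot all_order all_algebra.
From mathcomp Require Import boolp classical_sets reals.

Set Implicit Arguments.
Unset Strict Implicit.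
Unset Printing Implicit Defensive.

Fixpoint pell (k : nat) : nat :=
  match k with
  | 0 => 0
  | 1 => 1
  | (k''.+1 as k').+1 => 2 * pell k' + pell k''
  end.

Fixpoint pell_lucas (k : nat) : nat :=
  match k with
  | 0 => 2
  | 1 => 2
  | (k''.+1 as k').+1 => 2 * pell_lucas k' + pell_lucas k''
  end.

Definition neo_balcobalancing (m : nat) : Prop :=
  0 < m /\
  exists2 r : nat, 0 < r &
    \sum_(1 <= i < m) i + \sum_(1 <= i < m.+1) i
      = 2 * \sum_(m.-1 <= i < (m + r).+1) i.

(* m is the k-th neo balcobalancing number in increasing order (k >= 1) when
   it is one and exactly k of the integers 1, ..., m are. *)
Definition is_kth_neobc (k m : nat) : Prop :=
  neo_balcobalancing m /\
  count (fun j => `[< neo_balcobalancing j >]) (iota 1 m) = k.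

(* Junk value 0 if there is no k-th neo balcobalancing number, in particular
   for k = 0. *)
Definition Bneobc (k : nat) : nat :=
  xget 0 [set m | is_kth_neobc k m]%classic.

Definition Cneobc (R : realType) (k : nat) : R :=
  Num.sqrt (8 * (Bneobc k)%:R ^+ 2 - 12 * (Bneobc k)%:R + 9)%R.

(* Main.v *)
(** The defining equation amounts to m^2 = (r + 2)(2m + r - 1), whose discriminant in r
    shows that m > 0 is neo balcobalancing iff c^2 = 8 m^2 - 12 m + 9 for some c.
    All solutions in natural numbers of this Pell-type equation come from (0, 3) by
    iterating (m, c) |-> (17 m + 6 c - 12, 48 m + 17 c - 36), the map induced by
    multiplication by (3 + 2 sqrt 2)^2 on 4 m - 3 + c sqrt 2: descent along the
    inverse map stops only at (0, 3).  The iterates have increasing first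
    components, so the k-th one is the k-th neo balcobalancing number, and they
    are affine in the Pell numbers of index 4k and 4k + 1. *)
Require Import Defs.
From mathcomp Require Import all_boot all_order all_algebra.
From mathcomp Require Import boolp classical_sets reals.
From mathcomp Require Import zify lra.

Set Implicit Arguments.
Unset Strict Implicit.
Unset Printing Implicit Defensive.

Import GRing.Theory Num.Theory.

(** The seed [(0, 3)] is not neo balcobalancing, so index [k >= 1] is already the rank. The
    subtractions never truncate, since the second component stays at least 3. *)
Fixpoint neobc_pair (k : nat) : nat * nat :=
  if k is k'.+1 then
    let: (m, c) := neobc_pair k' in
    (17 * m + 6 * c - 12, 48 * m + 17 * c - 36)
  else (0, 3).

Definition neobcB k := (neobc_pair k).1.
Definition neobcC k := (neobc_pair k).2.

Lemma neobcBS k : neobcB k.+1 = 17 * neobcB k + 6 * neobcC k - 12.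
Proof. by rewrite /neobcB /neobcC /=; case: (neobc_pair k). Qed.

Lemma neobcCS k : neobcC k.+1 = 48 * neobcB k + 17 * neobcC k - 36.
Proof. by rewrite /neobcB /neobcC /=; case: (neobc_pair k). Qed.

Lemma neobcC_ge3 k : 3 <= neobcC k.
Proof. by elim: k => // k IH; rewrite neobcCS; lia. Qed.

(** Equivalently 4 m - 3 + c sqrt 2 has norm -9, which multiplication by an element of norm 1
    preserves. *)
Lemma neobcBC k : neobcC k ^ 2 + 12 * neobcB k = 8 * neobcB k ^ 2 + 9.
Proof.
elim: k => // k IH; have := neobcC_ge3 k; rewrite neobcBS neobcCS.
move: (neobcB k) (neobcC k) IH => b c IH c3.
have [m Em] : {m | 17 * b + 6 * c = m + 12}.
  by exists (17 * b + 6 * c - 12); lia.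
have [d Ed] : {d | 48 * b + 17 * c = d + 36}.
  by exists (48 * b + 17 * c - 36); lia.
by rewrite Em Ed !addnK; nia.
Qed.

Lemma neobcB_ltS k : neobcB k < neobcB k.+1.
Proof. by have := neobcC_ge3 k; rewrite neobcBS; lia. Qed.

Lemma neobcB_mono : {mono neobcB : i j / i <= j}.
Proof. exact/leq_mono/(homo_ltn ltn_trans)/neobcB_ltS. Qed.

Lemma neobc_descent m c : c ^ 2 + 12 * m = 8 * m ^ 2 + 9 ->
  exists k, m = neobcB k /\ c = neobcC k.
Proof.
have [N] := ubnP m; elim: N m c => // N IH m c mN E.
have [m0|m_gt0] := posnP m.
  by exists 0; rewrite /neobcB /neobcC /=; split=> //; nia.
(* From 1 to 5 the inverse map would give a negative first component; a finite search finds no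
   solution there. *)
have m6 : 6 <= m.
  rewrite leqNgt; apply/negP => m_lt6.
  have c15 : c < 15 by nia.
  have /allP/(_ m) : all (fun i => all (fun d => d ^ 2 + 12 * i != 8 * i ^ 2 + 9)
                                       (iota 0 15)) (iota 1 5) by [].
  rewrite mem_iota m_gt0 => /(_ m_lt6)/allP/(_ c).
  by rewrite mem_iota c15 => /(_ isT)/eqP.
(* The preimage is (17 m - 6 c - 12, 17 c + 36 - 48 m): [hm] and [hc] make it natural, [hl] makes
   its first component smaller than [m]. *)
have hm : 6 * c + 12 <= 17 * m by nia.
have hc : 48 * m <= 17 * c + 36 by nia.
have hl : 16 * m < 6 * c + 12 by nia.
have [m' Em] : {m' | 17 * m = m' + (6 * c + 12)}.
  by exists (17 * m - (6 * c + 12)); lia.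
have [c' Ec] : {c' | 17 * c + 36 = c' + 48 * m}.
  by exists (17 * c + 36 - 48 * m); lia.
have [||k [Bk Ck]] := IH m' c'; [lia|nia|].
by exists k.+1; rewrite neobcBS neobcCS -Bk -Ck; split; lia.
Qed.

Lemma sum_nat_interval a n :
  2 * \sum_(a <= i < a + n) i + n = n * (2 * a + n).
Proof.
elim: n => [|n IH]; first by rewrite !addn0 big_geq.
by rewrite (addnS a) big_nat_recr ?leq_addr //=; nia.
Qed.

Lemma neo_balcobalancing_eqn m r : 0 < m ->
  (\sum_(1 <= i < m) i + \sum_(1 <= i < m.+1) i
     = 2 * \sum_(m.-1 <= i < (m + r).+1) i)
  <-> m ^ 2 = (r + 2) * (2 * m + r - 1).
Proof.
case: m => // m _.
have := sum_nat_interval 1 m; have := sum_nat_interval 1 m.+1.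
have := sum_nat_interval m r.+2.
have -> : m + r.+2 = (m.+1 + r).+1 by lia.
rewrite !add1n /=.
move: (bigop.body _ _ _) (bigop.body _ _ _) (bigop.body _ _ _) => x y z.
have -> : 2 * m.+1 + r - 1 = 2 * m + r + 1 by lia.
by move=> Ex Ey Ez; split; nia.
Qed.

Lemma neo_balcobalancingP m :
  neo_balcobalancing m <-> exists k, m = neobcB k.+1.
Proof.
split=> [[m0 [r r0 /(neo_balcobalancing_eqn _ m0) E]]|[k -> {m}]].
  (* Solving the quadratic for [r] gives 2 r + 2 m + 1 as the square root of the discriminant. *)
  have [|[|k] [Bk _]] := @neobc_descent m (2 * m + 2 * r + 1).
  - move: E; case: m m0 => // m _.
    have -> : 2 * m.+1 + r - 1 = 2 * m + r + 1 by lia.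
    by nia.
  - by move: m0; rewrite Bk.
  - by exists k.
have B6 : 6 <= neobcB k.+1 by rewrite (neobcB_mono 1 k.+1).
have E := neobcBC k.+1.
move: (neobcB _) (neobcC _) B6 E => m c B6 E.
have m0 : 0 < m by apply: leq_trans B6.
split=> //.
(* Squared, this amounts to 4 m^2 >= 24 m, hence to [B6]; it will force [0 < r]. *)
have c_ge : 2 * m + 3 <= c by nia.
have [r Er] : {r | c = 2 * m + 2 * r + 1}.
  (* The division is exact because [c] is odd, its square plus 12 m being odd. *)
  exists ((c - (2 * m + 1)) %/ 2).
  have : odd (c ^ 2 + 12 * m) by rewrite E oddD oddM.
  by rewrite oddD oddM oddX addbF /=; lia.
exists r; first by lia.
apply/(neo_balcobalancing_eqn _ m0).
have -> : 2 * m + r - 1 = (m.-1 + m + r) by lia.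
by case: m m0 E Er {B6 c_ge} => [|m] // _ E Er /=; subst c; nia.
Qed.

(** Passing from one iterate to the next adds exactly one to the count: by monotonicity no other
    iterate lies in between. *)
Lemma count_neobc k :
  count (fun j => `[< neo_balcobalancing j >]) (iota 1 (neobcB k)) = k.
Proof.
elim: k => // k IH.
have lt := neobcB_ltS k.
rewrite -(subnKC (ltnW lt)) iotaD count_cat IH.
set s := iota _ _.
rewrite -[RHS]addn1; congr (_ + _).
rewrite (@eq_in_count _ _ (pred1 (neobcB k.+1))) => [|j].
  by rewrite count_uniq_mem ?iota_uniq // mem_iota; lia.
rewrite mem_iota => jint /=.
apply/asboolP/eqP => [/neo_balcobalancingP[i Ej]|->]; last first.
  by apply/neo_balcobalancingP; exists k.
have ki : k < i.+1 by rewrite ltnNge -neobcB_mono -ltnNge; lia.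
have ik : i.+1 <= k.+1 by rewrite -neobcB_mono; lia.
by rewrite Ej; congr neobcB; lia.
Qed.

(** Uniqueness holds because the count recovers the index of an iterate. *)
Lemma BneobcE k : Bneobc k.+1 = neobcB k.+1.
Proof.
apply: xget_unique => [|m [/neo_balcobalancingP[i ->]]].
  by split; [apply/neo_balcobalancingP; exists k | apply: count_neobc].
by rewrite count_neobc => ->.
Qed.

Lemma pellSS k : pell k.+2 = 2 * pell k.+1 + pell k.
Proof. by []. Qed.

Lemma pell_lucasSS k : pell_lucas k.+2 = 2 * pell_lucas k.+1 + pell_lucas k.
Proof. by []. Qed.

(** Both sides obey the Pell recurrence and agree at 0 and 1. This eliminates [pell_lucas] from the
    theorem. *)
Lemma pell_lucasE k : pell_lucas k + 2 * pell k = 2 * pell k.+1.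
Proof.
elim/ltn_ind: k => -[|[|k]] // IH.
have := IH k.+1 (ltnSn _); have := IH k (ltnW (ltnSn _)).
by rewrite pell_lucasSS !pellSS; lia.
Qed.

(* That is, C_k = 3 P_(4k-1) and B_k = 3 (Q_(4k-1) / 2 + 1) / 4, rewritten to
   avoid the index -1 at k = 0 and truncated subtraction. *)
Lemma neobc_pell k :
  neobcC k + 6 * pell (4 * k) = 3 * pell (4 * k).+1 /\
  4 * neobcB k + 3 * pell (4 * k).+1 = 3 + 9 * pell (4 * k).
Proof.
elim: k => [//|k [IHc IHb]]; have := neobcC_ge3 k.
by rewrite neobcBS neobcCS mulnS add4n !pellSS; lia.
Qed.

Local Open Scope ring_scope.

Lemma CneobcE (R : realType) k : Cneobc R k.+1 = (neobcC k.+1)%:R.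
Proof.
rewrite /Cneobc BneobcE.
have /(congr1 (fun x : nat => x%:R : R)) := neobcBC k.+1.
rewrite !(natrM, natrD) => E.
rewrite (_ : _ - _ + _ = (neobcC k.+1)%:R ^+ 2); last by lra.
by rewrite sqrtr_sqr normr_nat.
Qed.

Lemma neobc_pellR (R : realType) k :
  (neobcC k)%:R = 3 * (pell (4 * k).+1)%:R - 6 * (pell (4 * k))%:R :> R /\
  (neobcB k)%:R = 4^-1 * (3 + 9 * (pell (4 * k))%:R - 3 * (pell (4 * k).+1)%:R)
    :> R.
Proof.
have [/(congr1 (fun x : nat => x%:R : R)) Ec
      /(congr1 (fun x : nat => x%:R : R)) Eb] := neobc_pell k.
by move: Ec Eb; rewrite !(natrM, natrD); split; lra.
Qed.

Theorem theorem5p3 (R : realType) (n : nat) (hn : (1 <= n)%N) :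
  let B (k : nat) : R := (Bneobc k)%:R in
  let C (k : nat) : R := Cneobc R k in
  [/\ (pell (2 * n))%:R =
        3^-1 * (if odd n
                then 4 * B ((n + 1) %/ 2)%N - C ((n + 1) %/ 2)%N - 3
                else 20 * B ((n + 2) %/ 2)%N - 7 * C ((n + 2) %/ 2)%N - 15),
      (pell (2 * n - 1))%:R =
        6^-1 * (if odd n
                then - 16 * B ((n + 1) %/ 2)%N + 6 * C ((n + 1) %/ 2)%N + 12
                else 20 * B ((n + 2) %/ 2)%N - 4 * B (n %/ 2)%N
                     - 7 * C ((n + 2) %/ 2)%N + C (n %/ 2)%N - 12),
      (pell_lucas (2 * n))%:R =
        3^-1 * (if odd n
                then - 8 * B ((n + 1) %/ 2)%N + 4 * C ((n + 1) %/ 2)%N + 6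
                else 60 * B ((n + 2) %/ 2)%N - 4 * B (n %/ 2)%N
                     - 21 * C ((n + 2) %/ 2)%N + C (n %/ 2)%N - 42)
    & (pell_lucas (2 * n - 1))%:R =
        3^-1 * (if odd n
                then 24 * B ((n + 1) %/ 2)%N - 8 * C ((n + 1) %/ 2)%N - 18
                else 20 * B ((n + 2) %/ 2)%N + 4 * B (n %/ 2)%N
                     - 7 * C ((n + 2) %/ 2)%N - C (n %/ 2)%N - 18)].
Proof.
move=> B C.
have pellR k : (pell k.+2)%:R = 2 * (pell k.+1)%:R + (pell k)%:R :> R.
  by rewrite pellSS !(natrM, natrD).
have lucasR k : (pell_lucas k)%:R = 2 * (pell k.+1)%:R - 2 * (pell k)%:R :> R.
  have /(congr1 (fun x : nat => x%:R : R)) := pell_lucasE k.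
  by rewrite !(natrM, natrD); lra.
have BE k : B k.+1 = (neobcB k.+1)%:R by rewrite /B BneobcE.
have CE k : C k.+1 = (neobcC k.+1)%:R by rewrite /C CneobcE.
(* Writing n as 2 j + 1 or 2 j + 2 makes every index of [B] and [C] a successor. All terms then
   reduce to the Pell numbers of index 4 j and 4 j + 1, in which the claims are linear. *)
have [[j [Ej Oj]]|[j [Ej Oj]]] :
    (exists j, n = j.*2.+1 /\ odd n) \/ (exists j, n = j.*2.+2 /\ ~~ odd n).
- case: (boolP (odd n)) => O; [left; exists n./2|right; exists n./2.-1];
    by split=> //; lia.
- have E1 : ((n + 1) %/ 2 = j.+1)%N by lia.
  have E2 : (2 * n = (4 * j).+2)%N by lia.
  rewrite Oj /= E1 E2 subn1 succnK !lucasR BE CE.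
  have [-> ->] := neobc_pellR R j.+1.
  by rewrite mulnS add4n !pellR; split; lra.
- have E1 : ((n + 2) %/ 2 = j.+2)%N by lia.
  have E2 : (n %/ 2 = j.+1)%N by lia.
  have E3 : (2 * n = (4 * j).+4)%N by lia.
  rewrite (negbTE Oj) /= E1 E2 E3 subn1 succnK !lucasR !BE !CE.
  have [-> ->] := neobc_pellR R j.+1; have [-> ->] := neobc_pellR R j.+2.
  by rewrite !mulnS !add4n !pellR; split; lra.
Qed.
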